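(* On a nonempty finite metric space $X$, the uniform measure $\mu_X$ exists and is the uniform probability measure in the standard sense (each point of $X$ has measure $1/n$, where $n$ is the number of points of $X$).
   Context: For a metric space $X = (X,d)$ and $t>0$, $tX$ is the set $X$ with the metric $t d$. $P(X)$ is the set of (Radon) probability measures on $X$, with the weak* topology as a subset of the dual of $C(X)$. For a compact metric space $X=(X,d)$ and $\mu \in P(X)$, put $(K\mu)(x) = \int_X e^{-d(x,y)}\, d\mu(y)$. The diversity of order $q \in [0,\infty]$ of $\mu$ is $D_q^X(\mu) = \left( \int_X (K\mu)^{q-1}\, d\mu \right)^{1/(1-q)}$ for $q \neq 1,\infty$; $D_1^X(\mu) = \exp\left(-\int_X \log(K\mu)\, d\mu\right)$; $D_\infty^X(\mu) = 1/\operatorname{ess\,sup}_\mu K\mu$. A probability measure $\mu$ on $X$ is maximising if for every $q \in [0,\infty]$ it maximises $D_q^X$ over $P(X)$. The maximising measures on $tX$ are those defined with respect to the metric $td$ (kernel $e^{-t d(x,y)}$), regarded as probability measures on the fixed set $X$. Uniform measure: suppose that $tX$ has a unique maximising measure $\mu_t$ for all sufficiently large $t$, and that $\lim_{t\to\infty}\mu_t$ exists in $P(X)$. Then the uniform measure on $X$ is said to exist, and it is $\mu_X = \lim_{t\to\infty}\mu_t$. *)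

(* Defs.v *)
From HB Require Import structures.
From mathcomp Require Import all_boot all_order all_algebra.
From mathcomp Require Import all_classical all_reals all_analysis ess_sup_inf giry.

Set Implicit Arguments.
Unset Strict Implicit.
Unset Printing Implicit Defensive.

Import Order.TTheory GRing.Theory Num.Theory.
Import numFieldNormedType.Exports.

Local Open Scope classical_set_scope.
Local Open Scope ring_scope.

(* Nonempty metric spaces: the measurable types of the library are pointed.
   The chosen point plays no role below. *)
#[short(type="pmetricType")]
HB.structure Definition PointedMetric (K : numDomainType) :=
  {M of Metric K M & Pointed M}.

Definition borel {R : realType} (X : pmetricType R) :=
  g_sigma_algebraType (@open X).

(* P(X) is [probability (borel X) R]: every Borel probability measure on a
   compact metric space is Radon, so no regularity condition is needed. Its
   elements are functions on all subsets of X that are constrained on Borel sets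
   only; they are identified up to [measure_eq]. *)

Section diversity.
Context {R : realType} {X : pmetricType R}.
Implicit Types (d : X -> X -> R) (mu nu : probability (borel X) R) (q : \bar R).

(* The metric is an argument [d], so that P(X) is literally the same type for
   all the rescaled spaces tX; only [scaled_dist t] with t > 0 is used. *)
Definition scaled_dist (t : R) (x y : X) : R := t * mdist x y.

Definition typicality d mu (x : X) : R := \int[mu]_y expR (- d x y).

(* For compact X, typicality is continuous and bounded below by a positive
   constant, so every integral below is finite and [ln], [powR] and [^-1] are
   only evaluated at positive reals. The value at q = -oo, and more generally
   for q < 0, is irrelevant. *)
Definition diversity d q mu : R :=
  match q with
  | r%:E =>
      if r == 1 then expR (- \int[mu]_x ln (typicality d mu x))
      else (\int[mu]_x (typicality d mu x `^ (r - 1))) `^ (1 / (1 - r))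
  | +oo%E => 1 / fine (ess_sup mu (fun x => (typicality d mu x)%:E))
  | -oo%E => 0
  end.

Definition maximising d mu : Prop :=
  forall q, (0 <= q)%E -> forall nu, diversity d q nu <= diversity d q mu.

Definition unique_maximising d mu : Prop :=
  maximising d mu /\ forall nu, maximising d nu -> measure_eq nu mu.

Definition integral_of (f : continuousType X R) mu : R := \int[mu]_x f x.

(* P(X) with the weak* topology: the coarsest topology for which mu |-> \int f dmu
   is continuous for every f in C(X). *)
Definition weak_star : topologicalType :=
  sup_topology (fun f : continuousType X R =>
    Topological.class (initial_topology (integral_of f))).

Lemma weak_star_cvgP (F : set_system weak_star) mu : Filter F ->
  F --> (mu : weak_star) <->
  forall f : continuousType X R, integral_of f @ F --> integral_of f mu.
Proof.
move=> FF; split=> [/cvg_sup Fmu f|Fmu].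
  exact: cvg_comp (Fmu f) (@initial_continuous _ _ (integral_of f) mu).
apply/cvg_sup => f A [_ [[B oB <-] Bmu BA]].
by apply: filterS BA _; apply: (Fmu f); exact: open_nbhs_nbhs.
Qed.

Definition is_uniform_measure mu : Prop :=
  exists mu_ : R -> weak_star,
    (\forall t \near +oo, unique_maximising (scaled_dist t) (mu_ t)) /\
    mu_ t @[t --> +oo] --> (mu : weak_star).

End diversity.

(* Main.v *)
Require Import Defs.
From mathcomp Require Import all_boot all_order all_algebra.
From mathcomp Require Import all_classical all_reals all_analysis.
From mathcomp Require Import ess_sup_inf giry lra ring.

(** Write [Z] for the similarity matrix [exp (- t d(x, y))] of [tX]. As [t] grows,
    [Z] tends to the identity, so it is eventually positive definite and the
    solution [w] of [Z w = 1] is close to [1], in particular positive. For a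
    probability vector [p] with [u = Z p], positivity of [Z] on [p / u - w] yields
    [D_0(p) = \sum_i p i / u i <= \sum_i w i]. Each [D_q] is a power mean of [1 / u],
    so [D_q(p) <= D_0(p)] for [q >= 0] by convexity of the exponential. The measure
    [w / \sum_i w i] has constant typicality, so all its diversities equal
    [\sum_i w i]; conversely [D_2(p) >= \sum_i w i] forces [p = w / \sum_i w i] by
    definiteness. Finally [w -> 1] gives [w / \sum_i w i -> 1 / n]. *)

Set Implicit Arguments.
Unset Strict Implicit.
Unset Printing Implicit Defensive.

Import Order.TTheory GRing.Theory Num.Theory.
Import numFieldNormedType.Exports.

Local Open Scope classical_set_scope.
Local Open Scope card_scope.
Local Open Scope ring_scope.

(** * Matrices close to the identity *)

Section weighting.
Context {R : realFieldType} {n : nat}.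
Implicit Types (Z : 'M[R]_n) (w p x y : 'I_n -> R).

Definition bilin Z x y : R := \sum_i x i * \sum_j Z i j * y j.

Definition weighting Z w := forall i, \sum_j Z i j * w j = 1.

Definition near_identity Z (delta : R) :=
  [/\ forall i j, Z i j = Z j i, forall i j, 0 <= Z i j
    & forall i j, `|Z i j - (i == j)%:R| <= delta].

Lemma bilinC Z x y : (forall i j, Z i j = Z j i) -> bilin Z x y = bilin Z y x.
Proof.
move=> symZ; rewrite /bilin; under eq_bigr do rewrite mulr_sumr.
rewrite exchange_big /=; apply: eq_bigr => i _; rewrite mulr_sumr.
by apply: eq_bigr => j _; rewrite symZ; ring.
Qed.

(** Completing the square: [Z w = 1] reduces the cross terms and [bilin Z w w] to plain sums.
    Combined with positivity of the form, this identity yields both the upper bound on [D_0] and the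
    uniqueness of the maximiser. *)
Lemma bilin_subweighting Z w x : (forall i j, Z i j = Z j i) -> weighting Z w ->
  bilin Z (fun i => x i - w i) (fun i => x i - w i) =
  bilin Z x x - 2 * \sum_i x i + \sum_i w i.
Proof.
move=> symZ wZ.
have bw y : bilin Z y w = \sum_i y i.
  by apply: eq_bigr => i _; rewrite wZ mulr1.
have -> : bilin Z (fun i => x i - w i) (fun i => x i - w i) =
    bilin Z x x - bilin Z x w - bilin Z w x + bilin Z w w.
  rewrite /bilin -!sumrB -big_split; apply: eq_bigr => i _ /=.
  under eq_bigr do rewrite mulrBr.
  by rewrite sumrB; ring.
by rewrite (bilinC w x symZ) !bw; ring.
Qed.

Lemma sum_kronecker (i : 'I_n) x : \sum_j (i == j)%:R * x j = x i.
Proof.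
rewrite (bigD1 i)//= eqxx mul1r big1 ?addr0// => j ji.
by rewrite eq_sym (negbTE ji) mul0r.
Qed.

(** The identity contributes [\sum_i x i ^+ 2]. The rest is bounded through
    [|x i * x j| <= (x i ^+ 2 + x j ^+ 2) / 2], whose double sum produces the factor [n]. *)
Lemma near_identity_bilin_ge Z delta x : near_identity Z delta ->
  (1 - n%:R * delta) * \sum_i x i ^+ 2 <= bilin Z x x.
Proof.
move=> [_ _ nearZ].
have -> : bilin Z x x = \sum_i x i ^+ 2 +
    \sum_i \sum_j (Z i j - (i == j)%:R) * (x i * x j).
  rewrite /bilin -big_split; apply: eq_bigr => i _ /=.
  under [in RHS]eq_bigr do rewrite mulrBl.
  rewrite sumrB sum_kronecker mulr_sumr expr2 addrC subrK.
  by apply: eq_bigr => j _; ring.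
rewrite mulrBl mul1r lerD2l lerNl -sumrN.
have -> : (n%:R * delta * \sum_i x i ^+ 2) =
    \sum_i \sum_j delta * ((x i ^+ 2 + x j ^+ 2) / 2).
  under [RHS]eq_bigr do rewrite -mulr_sumr -mulr_suml big_split /= sumr_const card_ord.
  rewrite -mulr_sumr -mulr_suml big_split /= sumrMnl sumr_const card_ord.
  by rewrite -mulr_natl; field.
apply: ler_sum => i _; rewrite -sumrN; apply: ler_sum => j _.
apply: le_trans (ler_norm _) _; rewrite normrN normrM.
apply: ler_pM => //; rewrite ler_norml.
have := sqr_ge0 (x i - x j); have := sqr_ge0 (x i + x j).
by rewrite !expr2; lra.
Qed.

Lemma near_identity_definite Z delta x : near_identity Z delta ->
  n%:R * delta < 1 -> bilin Z x x <= 0 -> forall i, x i = 0.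
Proof.
move=> nearZ nd x0 i; apply/eqP; rewrite -sqrf_eq0.
have x2 (j : 'I_n) : true -> 0 <= x j ^+ 2 by rewrite sqr_ge0.
suff /eqP : \sum_j x j ^+ 2 = 0 by
  rewrite psumr_eq0// => /allP/(_ i (mem_index_enum i)).
apply/eqP; rewrite eq_le sumr_ge0// andbT.
have := le_trans (near_identity_bilin_ge x nearZ) x0.
by rewrite pmulr_rle0// subr_gt0.
Qed.

Definition inv_weighting Z (i : 'I_n) : R := (invmx Z *m const_mx 1) i (0 : 'I_1).

Lemma inv_weightingP Z delta : near_identity Z delta -> n%:R * delta < 1 ->
  weighting Z (inv_weighting Z).
Proof.
move=> nearZ nd; have [symZ _ _] := nearZ.
have unitZ : Z \in unitmx.
  (* A row vector [v] with [v Z = 0] has [bilin Z v v = 0], so definiteness makes it vanish. *)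
  rewrite -row_free_unit; apply: inj_row_free => v vZ0; apply/rowP => i.
  rewrite mxE; apply: (@near_identity_definite Z delta (v 0)) => //.
  rewrite /bilin big1// => j _.
  have /rowP/(_ j) := vZ0; rewrite !mxE => vZj0.
  under eq_bigr do rewrite symZ mulrC.
  by rewrite vZj0 mulr0.
move=> i.
have /matrixP/(_ i 0) := mulKVmx unitZ (const_mx 1 : 'M[R]_(n, 1)).
by rewrite !mxE.
Qed.

(** Entrywise, [w - 1 = w - Z w] is at most [delta * S], where [S] is the l1-norm of [w]. Summing
    over [i] gives [S <= n + n * delta * S <= n + S / 2], hence [S <= 2 * n]. *)
Lemma weighting_near1 Z delta w : near_identity Z delta ->
  n%:R * delta <= 2^-1 -> weighting Z w ->
  forall i, `|w i - 1| <= 2 * n%:R * delta.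
Proof.
move=> [_ _ nearZ] nd wZ.
pose S := \sum_i `|w i|.
have w1 i : `|w i - 1| <= delta * S.
  rewrite -(wZ i) distrC.
  have -> : \sum_j Z i j * w j - w i = \sum_j (Z i j - (i == j)%:R) * w j.
    under [RHS]eq_bigr do rewrite mulrBl.
    by rewrite sumrB sum_kronecker.
  apply: le_trans (ler_norm_sum _ _ _) _; rewrite /S mulr_sumr.
  by apply: ler_sum => j _; rewrite normrM ler_wpM2r.
have S0 : 0 <= S by apply: sumr_ge0.
have S2 : S <= 2 * n%:R.
  have SS : S <= n%:R * (1 + delta * S).
    rewrite [leRHS]mulr_natl -[n in leRHS]card_ord -sumr_const.
    apply: ler_sum => i _; have := ler_normD (w i - 1) 1.
    by rewrite subrK normr1; have := w1 i; lra.
  by have := ler_wpM2r S0 nd; rewrite mulrDr mulr1 mulrA in SS; lra.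
move=> i; apply: le_trans (w1 i) _.
have d0 : 0 <= delta by apply: le_trans (nearZ i i).
by rewrite [leRHS]mulrC ler_wpM2l.
Qed.

(* Test the positivity of [bilin Z] on [x - w] with [x i = p i / (Z p) i]:
   AM-GM gives [bilin Z x x <= \sum_i x i]. *)
Lemma sum_div_typicality_le Z delta w p : near_identity Z delta ->
  n%:R * delta < 1 -> weighting Z w -> (forall i, 0 <= p i) ->
  (forall i, 0 < \sum_j Z i j * p j) ->
  \sum_i p i / (\sum_j Z i j * p j) <= \sum_i w i.
Proof.
move=> nearZ nd wZ p0; set u := fun i => \sum_j Z i j * p j => u0.
have [symZ Z0 _] := nearZ.
pose x i := p i / u i; rewrite -/(\sum_i x i).
have : 0 <= bilin Z (fun i => x i - w i) (fun i => x i - w i).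
  apply: le_trans (near_identity_bilin_ge _ nearZ).
  by rewrite mulr_ge0 ?sumr_ge0 ?subr_ge0 1?ltW// => i _; rewrite sqr_ge0.
rewrite bilin_subweighting//.
suff : bilin Z x x <= \sum_i x i by lra.
(* As [u i = \sum_j Z i j * p j], each [x i] is the sum over [j] of [Z i j * p i * p j / u i ^+ 2].
   Symmetry of [Z] allows averaging over the exchange of [i] and [j], after which AM-GM applies term
   by term. *)
have -> : \sum_i x i = \sum_i \sum_j Z i j * p i * p j * ((u i)^-2 + (u j)^-2) / 2.
  have e : \sum_i x i = \sum_i \sum_j Z i j * p i * p j * (u i)^-2.
    apply: eq_bigr => i _.
    transitivity (\sum_j (p i / u i ^+ 2) * (Z i j * p j)).
      by rewrite -mulr_sumr -/(u i) /x; field; rewrite gt_eqF ?u0.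
    by apply: eq_bigr => j _; ring.
  have e' : \sum_i x i = \sum_i \sum_j Z i j * p i * p j * (u j)^-2.
    rewrite e exchange_big/=; apply: eq_bigr => i _; apply: eq_bigr => j _.
    by rewrite symZ; ring.
  transitivity ((\sum_i x i + \sum_i x i) / 2); first by field.
  rewrite {1}e e' -big_split mulr_suml; apply: eq_bigr => i _ /=.
  by rewrite -big_split mulr_suml; apply: eq_bigr => j _ /=; ring.
apply: ler_sum => i _; rewrite mulr_sumr; apply: ler_sum => j _.
rewrite [leLHS](_ : _ = Z i j * p i * p j * ((u i)^-1 * (u j)^-1)); last first.
  by rewrite /x; ring.
rewrite -[leRHS]mulrA ler_wpM2l ?mulr_ge0//.
by rewrite -!exprVn; have := sqr_ge0 ((u i)^-1 - (u j)^-1); rewrite !expr2; lra.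
Qed.

(** The form at [p * B - w] equals [B ^+ 2 * bilin Z p p - B], which the bound on [bilin Z p p]
    makes nonpositive; definiteness then forces [p * B = w]. *)
Lemma min_bilin_weighting Z delta w p : near_identity Z delta ->
  n%:R * delta < 1 -> weighting Z w -> 0 < \sum_i w i -> \sum_i p i = 1 ->
  bilin Z p p <= (\sum_i w i)^-1 -> forall i, p i = w i / \sum_i w i.
Proof.
move=> nearZ nd wZ; set B := \sum_i w i => B0 p1 pZp i.
have [symZ _ _] := nearZ.
suff /near_identity_definite :
    bilin Z (fun i => p i * B - w i) (fun i => p i * B - w i) <= 0.
  move=> /(_ _ nearZ nd i)/eqP; rewrite subr_eq0 => /eqP <-.
  by rewrite mulfK ?gt_eqF.
rewrite (bilin_subweighting (fun i => p i * B))// -mulr_suml p1 -/B.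
have -> : bilin Z (fun i => p i * B) (fun i => p i * B) = bilin Z p p * B ^+ 2.
  rewrite /bilin mulr_suml; apply: eq_bigr => j _.
  by under eq_bigr do rewrite mulrA; rewrite -mulr_suml; ring.
have : bilin Z p p * B ^+ 2 <= B.
  by rewrite expr2 mulrA -ler_pdivlMr// divff ?gt_eqF// -ler_pdivlMr// mul1r.
lra.
Qed.

End weighting.

(** * Power means *)

Section power_means.
Context {R : realType} {n : nat}.
Variables (p v : 'I_n -> R) (B : R).
Hypotheses (p0 : forall i, 0 <= p i) (p1 : \sum_i p i = 1).
Hypotheses (v0 : forall i, 0 < v i) (B0 : 0 < B).
Hypothesis pvB : \sum_i p i / v i <= B.

(** Since [expR (z i) = 1 / (v i * B)], the bound [pvB] says that the [p]-mean of [expR (z i)] is at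
    most [1], and comparing a mean with [B] becomes comparing with [1]. *)
Let z i := - ln (v i * B).

Let vE i : v i = expR (- z i) / B.
Proof. by rewrite opprK lnK ?posrE ?mulr_gt0// mulfK ?gt_eqF. Qed.

Let sum_expz : \sum_i p i * (expR (z i) - 1) <= 0.
Proof.
under eq_bigr do rewrite mulrBr mulr1.
rewrite sumrB p1 subr_le0 -(ler_pM2r B0) mul1r mulr_suml; apply: le_trans pvB.
apply: ler_sum => i _; rewrite vE expRN invfM !invrK.
by rewrite mulrA.
Qed.

(** The mean equals [B] times [T] to the power [1 / s], so the claim is [ln T / s <= 0]. It follows
    by comparing [expR (s * z i) - 1] with [s * (expR (z i) - 1)], in a direction given by the sign
    of [s]. *)
Lemma powR_mean_le (r : R) : 0 <= r -> r != 1 ->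
  (\sum_i p i * v i `^ (r - 1)) `^ (1 / (1 - r)) <= B.
Proof.
move=> r0 r1; pose s := 1 - r; have s_neq0 : s != 0 by rewrite subr_eq0 eq_sym.
pose T := \sum_i p i * expR (s * z i).
have -> : \sum_i p i * v i `^ (r - 1) = expR (s * ln B) * T.
  rewrite mulr_sumr; apply: eq_bigr => i _; rewrite /powR gt_eqF// mulrCA.
  rewrite -expRD; congr (_ * expR _); rewrite /z lnM ?posrE// /s; ring.
have T0 : 0 < T.
  rewrite lt_neqAle sumr_ge0 ?andbT => [|i _]; last by rewrite mulr_ge0 ?expR_ge0.
  apply/eqP => /esym sum0; have := oner_neq0 R; rewrite -[X in X != _]p1.
  rewrite big1 ?eqxx// => i _; apply/eqP.
  have pe0 j : true -> 0 <= p j * expR (s * z j) by rewrite mulr_ge0 ?expR_ge0.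
  have := psumr_eq0P pe0 sum0; move=> /(_ i isT) /eqP.
  by rewrite mulf_eq0 [expR _ == 0]gt_eqF ?expR_gt0// orbF.
rewrite /powR gt_eqF ?mulr_gt0 ?expR_gt0// lnM ?posrE ?expR_gt0// expRK.
rewrite [X in expR X](_ : _ = ln B + ln T / s); last first.
  by rewrite -/s; field.
rewrite expRD lnK ?posrE// -[leRHS]mulr1 ler_pM2l//.
rewrite -[leRHS]expR0 ler_expR.
have T1 : T - 1 = \sum_i p i * (expR (s * z i) - 1).
  by under [RHS]eq_bigr do rewrite mulrBr mulr1; rewrite sumrB p1.
have [s0|s0|s0] := ltgtP s 0; last by rewrite s0 eqxx in s_neq0.
(* For [s < 0], the tangent at [0] used twice gives [expR (s * z) - 1 >= s * z >= s * (expR z - 1)],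
   so [T >= 1]. *)
- rewrite nmulr_lle0 ?invr_lt0// ln_ge0// -subr_ge0 T1.
  have : 0 <= s * \sum_i p i * (expR (z i) - 1) by rewrite nmulr_rge0.
  move=> /le_trans; apply; rewrite mulr_sumr; apply: ler_sum => i _.
  rewrite mulrCA ler_wpM2l//.
  have := expR_ge1Dx (s * z i); have := expR_ge1Dx (z i).
  by move=> /(ler_wnM2l (ltW s0)); lra.
(* For [0 < s <= 1], where [r >= 0] enters, convexity gives [expR (s * z) <= 1 - s + s * expR z], so
   [T <= 1]. It is obtained from tangent lines at [s * z], after dividing by [expR (s * z)]. *)
- rewrite pmulr_lle0 ?invr_gt0// ln_le0// -subr_le0 T1.
  have : s * \sum_i p i * (expR (z i) - 1) <= 0 by rewrite pmulr_rle0.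
  apply: le_trans; rewrite mulr_sumr; apply: ler_sum => i _.
  rewrite mulrCA ler_wpM2l//.
  have szl : 1 - s * z i <= expR (- (s * z i)) by exact: expR_ge1Dx.
  have szr : 1 + (1 - s) * z i <= expR ((1 - s) * z i) by exact: expR_ge1Dx.
  have r_ge0 : 0 <= 1 - s by rewrite /s; lra.
  have : 1 <= (1 - s) * expR (- (s * z i)) + s * expR ((1 - s) * z i).
    by have := ler_wpM2l r_ge0 szl; have := ler_wpM2l (ltW s0) szr; lra.
  move=> /(ler_wpM2l (expR_ge0 (s * z i))).
  rewrite mulr1 mulrDr mulrCA -expRD subrr expR0 [X in _ + X]mulrCA -expRD.
  by rewrite [s * z i + _](_ : _ = z i); [lra|ring].
Qed.

(** The logarithm of the mean is [ln B] plus the [p]-mean of [z], and [z <= expR z - 1]. *)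
Lemma geometric_mean_le : expR (- \sum_i p i * ln (v i)) <= B.
Proof.
rewrite -[leRHS]lnK ?posrE// ler_expR.
have -> : - \sum_i p i * ln (v i) = ln B + \sum_i p i * z i.
  rewrite -[ln B]mulr1 -p1 mulr_sumr -big_split -sumrN; apply: eq_bigr => i _ /=.
  by rewrite /z lnM ?posrE//; ring.
rewrite gerDl; apply: le_trans sum_expz; apply: ler_sum => i _.
by rewrite ler_wpM2l//; have := expR_ge1Dx (z i); lra.
Qed.

Lemma inv_max_le (s : R) : (forall i, 0 < p i -> v i <= s) -> 1 / s <= B.
Proof.
move=> vs.
(* Since [1 / 0 = 0], the bound is trivial for every [s <= 0]. *)
have [s0|s0] := leP s 0.
  by rewrite (le_trans _ (ltW B0))// mul1r invr_le0.
rewrite ler_pdivrMr//.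
suff : 1 <= (\sum_i p i / v i) * s by move=> /le_trans; apply; rewrite ler_pM2r.
rewrite -[leLHS]p1.
rewrite mulr_suml; apply: ler_sum => i _.
have [-> |pi0] := eqVneq (p i) 0; first by rewrite !mul0r.
rewrite mulrAC ler_pdivlMr// ler_wpM2l// vs//.
by rewrite lt_neqAle eq_sym pi0 p0.
Qed.

End power_means.

(** * Measures on a finite metric space *)

Section finite_space.
Context {R : realType} {X : pmetricType R} {n : nat}.
Variable e : 'I_n -> X.
Hypothesis bij_e : bijective e.
Implicit Types (mu nu : probability (borel X) R) (d : X -> X -> R).

(** Every complement is finite, and finite sets are closed in a Hausdorff space. *)
Lemma finite_metric_open (A : set X) : open A.
Proof.
rewrite -closedC; apply: (accessible_finite_set_closed.1) => //.
  exact/hausdorff_accessible/metric_hausdorff.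
have [f _ fK] := bij_e.
apply: (@sub_finite_set _ _ (e @` [set: 'I_n])); last exact: finite_image.
by move=> x _; exists (f x).
Qed.

Lemma finite_borel_measurable (A : set (borel X)) : measurable A.
Proof. by apply: sub_sigma_algebra; exact: finite_metric_open. Qed.

Definition mass mu (i : 'I_n) : R := fine (mu [set e i]).

Lemma mass_ge0 mu i : 0 <= mass mu i.
Proof. exact: fine_ge0. Qed.

Lemma massE mu i : mu [set e i] = (mass mu i)%:E.
Proof. by rewrite /mass fineK// fin_num_measure//; exact: finite_borel_measurable. Qed.

Lemma finite_integral mu (f : borel X -> R) :
  (\int[mu]_x (f x)%:E = (\sum_i f (e i) * mass mu i)%:E)%E.
Proof.
have [g gK eK] := bij_e.
have -> : [set: borel X] = \big[setU/set0]_(i <- index_enum 'I_n) [set e i : borel X].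
  apply/seteqP; split=> // x _; rewrite -bigcup_seq; exists (g x) => /=.
    by rewrite mem_index_enum.
  by rewrite eK.
rewrite integral_bigsetU_EFin//.
- rewrite -sumEFin; apply: eq_bigr => i _.
  rewrite (eq_integral (cst (f (e i))%:E)) => [|x]; last by rewrite inE => ->.
  rewrite integral_cst ?EFinM -?massE//; exact: finite_borel_measurable.
- by move=> i; exact: finite_borel_measurable.
- exact: index_enum_uniq.
- by move=> i j _ _ [x [-> /= /(bij_inj bij_e)]].
- by move=> _ Y _; exact: finite_borel_measurable.
Qed.

Lemma finite_Rintegral mu (f : borel X -> R) :
  \int[mu]_x f x = \sum_i f (e i) * mass mu i.
Proof. by rewrite /Rintegral finite_integral. Qed.

Lemma probability_Rintegral_cst mu (c : R) : \int[mu]_x c = c.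
Proof.
rewrite Rintegral_cst// -[RHS]mulr1; congr (_ * _).
exact: (congr1 fine (probability_setT mu)).
Qed.

Lemma sum_mass mu : \sum_i mass mu i = 1.
Proof.
rewrite -[RHS](probability_Rintegral_cst mu) finite_Rintegral.
by apply: eq_bigr => i _; rewrite mul1r.
Qed.

Lemma mass_inj mu nu : mass mu =1 mass nu -> measure_eq mu nu.
Proof.
move=> munu A mA.
have H (xi : probability (borel X) R) : xi A = (\sum_i \1_A (e i) * mass xi i)%:E.
  by rewrite -finite_integral integral_indic// setIT.
apply: etrans (H mu) _; apply: etrans _ (esym (H nu)).
by congr EFin; apply: eq_bigr => i _; rewrite munu.
Qed.

(** A point of positive mass cannot lie in the null set where the essential supremum fails to be an
    upper bound. *)
Lemma mass_ess_sup mu (f : borel X -> R) i :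
  0 < mass mu i -> ((f (e i))%:E <= ess_sup mu (EFin \o f))%E.
Proof.
move=> mui; rewrite leNgt; apply/negP => fi.
have [N [mN N0 sN]] : \forall x \ae mu, ((f x)%:E <= ess_sup mu (EFin \o f))%E.
  by apply: ess_sup_ge.
move: mui; rewrite -lte_fin -massE ltNge => /negP; apply.
apply: (@le_trans _ _ (mu N)); last by rewrite N0.
apply: le_measure; rewrite ?inE//; first exact: finite_borel_measurable.
by move=> _ ->; apply: sN => /=; rewrite leNgt fi.
Qed.

(** * Maximality of the normalised weighting *)

Section maximiser.
Variables (d : X -> X -> R) (Z : 'M[R]_n) (delta : R) (w : 'I_n -> R).
Hypothesis ZE : forall i j, Z i j = expR (- d (e i) (e j)).
Hypothesis nearZ : near_identity Z delta.
Hypothesis nd : n%:R * delta < 1.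
Hypothesis wZ : weighting Z w.
Hypothesis w0 : forall i, 0 < w i.
Variable mu : probability (borel X) R.
Hypothesis muE : forall i, mass mu i = w i / \sum_j w j.

Let B := \sum_j w j.

Lemma typicalityE nu i : typicality d nu (e i) = \sum_j Z i j * mass nu j.
Proof. by rewrite /typicality finite_Rintegral; apply: eq_bigr => j _; rewrite ZE. Qed.

Lemma typicality_gt0 nu i : 0 < typicality d nu (e i).
Proof.
rewrite typicalityE lt_neqAle sumr_ge0 ?andbT => [|j _]; last first.
  by rewrite mulr_ge0 ?mass_ge0// ZE expR_ge0.
apply/eqP => /esym sum0; have := oner_neq0 R; rewrite -[X in X != _](sum_mass nu).
rewrite big1 ?eqxx// => j _; apply/eqP.
have zp0 k : true -> 0 <= Z i k * mass nu k.
  by rewrite mulr_ge0 ?mass_ge0// ZE expR_ge0.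
have := psumr_eq0P zp0 sum0; move=> /(_ j isT) /eqP.
by rewrite mulf_eq0 ZE gt_eqF ?expR_gt0.
Qed.

Let B0 : 0 < B.
Proof.
rewrite lt_neqAle sumr_ge0 ?andbT => [|i _]; last exact: ltW.
(* If [B = 0], division by zero would make every mass [0], against total mass [1]. This argument
   also covers [n = 0]. *)
apply/eqP => B0; have := oner_neq0 R; rewrite -[X in X != _](sum_mass mu).
by rewrite big1 ?eqxx// => i _; rewrite muE -/B -B0 invr0 mulr0.
Qed.

Lemma diversity_le q nu : (0 <= q)%E -> diversity d q nu <= B.
Proof.
have v0 := typicality_gt0 nu.
have pvB : \sum_i mass nu i / typicality d nu (e i) <= B.
  under eq_bigr do rewrite typicalityE.
  apply: (sum_div_typicality_le nearZ nd wZ) => i; first exact: mass_ge0.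
  by rewrite -typicalityE.
case: q => [r| |]//= r0.
- case: ifPn => r1; rewrite finite_Rintegral; under eq_bigr do rewrite mulrC.
    exact: geometric_mean_le (mass_ge0 nu) (sum_mass nu) v0 B0 pvB.
  by apply: (powR_mean_le (mass_ge0 nu) (sum_mass nu) v0 B0 pvB); rewrite // -lee_fin.
- apply: (inv_max_le (mass_ge0 nu) (sum_mass nu) v0 B0 pvB) => i pi0.
  have tsup := @mass_ess_sup nu (typicality d nu) i pi0.
  (* [fine] sends infinite values to [0], so the essential supremum must be shown finite. The sum of
     all typicalities is an upper bound because each of them is positive. *)
  have [M leM] : exists M, forall x, typicality d nu x <= M.
    have [f _ fK] := bij_e; exists (\sum_j typicality d nu (e j)) => x.
    rewrite -(fK x) (bigD1 (f x))//= lerDl sumr_ge0// => j _.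
    by rewrite ltW ?typicality_gt0.
  have supM : (ess_sup nu (fun x => (typicality d nu x)%:E) <= M%:E)%E.
    by apply/ess_supP; apply: aeW => x; rewrite lee_fin leM.
  rewrite -lee_fin [leRHS]fineK//; apply: fin_real; rewrite (lt_le_trans _ tsup) ?ltNyr//=.
  exact: le_lt_trans supM (ltry _).
Qed.

Lemma diversity_weighting q : (0 <= q)%E -> diversity d q mu = B.
Proof.
have [f _ fK] := bij_e.
have t_B : typicality d mu = cst B^-1.
  apply/funext => x; rewrite -(fK x) typicalityE.
  under eq_bigr do rewrite muE mulrA.
  by rewrite -mulr_suml wZ mul1r.
case: q => [r| |]//= r0; rewrite t_B/=.
- case: ifPn => r1.
    by rewrite probability_Rintegral_cst lnV ?posrE// opprK lnK.
  rewrite probability_Rintegral_cst -powRrM -powR_inv1 ?ltW// -powRrM.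
  rewrite (_ : _ * _ = 1) ?powRr1 ?ltW//.
  by field; rewrite subr_eq0 eq_sym.
- rewrite ess_sup_cst/= ?mul1r ?invrK//.
  by apply: lt_le_trans (lte01) _; rewrite -(probability_setT mu).
Qed.

Lemma unique_maximising_weighting : unique_maximising d mu.
Proof.
split=> [q q0 nu|nu maxnu].
  by rewrite diversity_weighting// diversity_le.
apply: mass_inj => i; rewrite muE.
apply: (min_bilin_weighting nearZ nd wZ B0 (sum_mass nu)).
(* Order [2] alone gives uniqueness: [D_2] is the inverse of [bilin Z p p] for [p] the mass vector
   of [nu]. *)
have := maxnu 2%:E; rewrite lee_fin => /(_ (ler0n _ _) mu).
rewrite diversity_weighting ?lee_fin// /diversity.
rewrite pnatr_eq1/=.
rewrite finite_Rintegral.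
have -> : \sum_i typicality d nu (e i) `^ (2 - 1) * mass nu i =
    bilin Z (mass nu) (mass nu).
  apply: eq_bigr => j _.
  rewrite (_ : 2 - 1 = 1 :> R); last by ring.
  rewrite powRr1; last exact/ltW/typicality_gt0.
  by rewrite mulrC typicalityE.
rewrite (_ : 1 / (1 - 2) = - 1 :> R); last first.
  by rewrite (_ : 1 - 2 = - 1 :> R) ?invrN1 ?mul1r//; ring.
have b0 : 0 <= bilin Z (mass nu) (mass nu).
  apply: sumr_ge0 => j _.
  by rewrite mulr_ge0 ?mass_ge0// -typicalityE ltW ?typicality_gt0.
rewrite powR_inv1// => Bb.
have [b_gt0|//] := ltP 0 (bilin Z (mass nu) (mass nu)).
  by rewrite -[leLHS]invrK lef_pV2 ?posrE ?invr_gt0.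
by move=> /le_trans; apply; rewrite invr_ge0 ltW.
Qed.
End maximiser.

End finite_space.

(** * Large scales *)

Lemma cvgr_sum {R : realType} {T I : Type} (F : set_system T) (r : seq I)
    (P : pred I) (f : I -> T -> R) (l : I -> R) : Filter F ->
  (forall i, P i -> f i x @[x --> F] --> l i) ->
  \sum_(i <- r | P i) f i x @[x --> F] --> \sum_(i <- r | P i) l i.
Proof. by move=> FF fl; apply: cvg_big => //; exact: add_continuous. Qed.

(** [mnormalize] falls back on [P] when the total mass is zero or infinite; a positive real [c]
    excludes both. *)
Lemma mnormalizeE d (T : measurableType d) (R : realType) (mu : measure T R)
    (P : probability T R) (A : set T) (a c : R) :
  mu setT = c%:E -> 0 < c -> mu A = a%:E -> mnormalize mu P A = (a / c)%:E.
Proof. by move=> muT c0 muA; rewrite /mnormalize muT eqe gt_eqF//= muA. Qed.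

Section point_masses.
Context {R : realType} {X : pmetricType R} {n : nat}.
Variable e : 'I_n.+1 -> X.
Hypothesis bij_e : bijective e.
Implicit Types (w : 'I_n.+1 -> R).

(** The absolute values and the Dirac fallback make this a probability for every [w]; [msum] is
    indexed by natural numbers, hence [inord]. *)
Definition point_masses w : probability (borel X) R :=
  mnormalize
    (msum (fun k => mscale `|w (inord k)|%:nng (dirac (e (inord k) : borel X))) n.+1)
    (dirac (e ord0 : borel X)).

Lemma mass_point_masses w i : (forall j, 0 < w j) ->
  mass e (point_masses w) i = w i / \sum_j w j.
Proof.
move=> w0.
have muE A : msum (fun k => mscale `|w (inord k)|%:nng (dirac (e (inord k) : borel X)))
    n.+1 A = (\sum_j w j * \1_A (e j))%:E.
  rewrite /msum -sumEFin; apply: eq_bigr => j _.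
  rewrite /mscale inord_val EFinM; congr (_%:E * _)%E.
  exact: gtr0_norm.
have S0 : 0 < \sum_j w j.
  rewrite big_ord_recl ltr_wpDr ?w0// sumr_ge0// => j _; exact: ltW.
have muT : msum (fun k => mscale `|w (inord k)|%:nng (dirac (e (inord k) : borel X)))
    n.+1 setT = (\sum_j w j)%:E.
  by rewrite muE; congr EFin; apply: eq_bigr => j _; rewrite indicT mulr1.
have muA : \sum_j w j * \1_[set e i] (e j) = w i.
  rewrite (bigD1 i)//= indicE mem_set// mulr1 big1 ?addr0// => j ji.
  rewrite indicE memNset ?mulr0// => /(bij_inj bij_e) ij.
  by rewrite ij eqxx in ji.
have muEA := etrans (muE [set e i]) (congr1 EFin muA).
exact: (congr1 fine (mnormalizeE (dirac (e ord0 : borel X)) muT S0 muEA)).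
Qed.

Definition similarity (t : R) : 'M[R]_n.+1 :=
  \matrix_(i, j) expR (- scaled_dist t (e i) (e j)).

(** A crude common bound for all entries of [Z - 1]; being a finite sum, it tends to [0] term by
    term. *)
Definition similarity_gap (t : R) : R :=
  \sum_i \sum_(j | j != i) similarity t i j.

Lemma similarity_near_identity t : near_identity (similarity t) (similarity_gap t).
Proof.
have gap0 i (P : pred 'I_n.+1) : 0 <= \sum_(j | P j) similarity t i j.
  by apply: sumr_ge0 => j _; rewrite mxE expR_ge0.
split=> [i j|i j|i j]; first by rewrite !mxE /scaled_dist metric_sym.
  by rewrite mxE expR_ge0.
have [<-|ij] := eqVneq i j.
  rewrite mxE /scaled_dist mdistxx mulr0 oppr0 expR0 subrr normr0.
  by apply: sumr_ge0 => k _; exact: gap0.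
rewrite subr0 ger0_norm; last by rewrite mxE expR_ge0.
rewrite /similarity_gap (bigD1 i)//= (bigD1 j) 1?eq_sym//= -addrA lerDl.
by rewrite addr_ge0// sumr_ge0// => k _; exact: gap0.
Qed.

Lemma similarity_gap_cvg0 : similarity_gap t @[t --> +oo] --> 0.
Proof.
rewrite (_ : 0 = \sum_(i < n.+1) \sum_(j < n.+1 | j != i) (0 : R)); last first.
  by rewrite big1// => i _; rewrite big1.
apply: cvgr_sum => i _; apply: cvgr_sum => j ji.
have dij : 0 < mdist (e i) (e j).
  by rewrite mdist_gt0; apply: contraNneq ji => /(bij_inj bij_e) ->.
under eq_cvg do rewrite mxE /scaled_dist.
apply: (@cvg_comp _ _ _ (fun t : R => t * mdist (e i) (e j))
  (fun x => expR (- x))); last exact: cvgr_expR.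
exact: gt0_cvgMly.
Qed.

(** The factor is the one in [weighting_near1]: [c = 1] makes the weighting positive, and arbitrary
    [c] makes it converge to [1]. *)
Lemma similarity_gap_lt c : 0 < c ->
  \forall t \near +oo, 2 * n.+1%:R * similarity_gap t < c.
Proof.
move=> c0; have c'0 : 0 < c / (2 * n.+1%:R) by rewrite divr_gt0// mulr_gt0.
apply: filterS (cvgr_lt _ similarity_gap_cvg0 _ c'0) => t.
by rewrite ltr_pdivlMr ?mulr_gt0// mulrC.
Qed.

Definition scaled_weighting t := inv_weighting (similarity t).

Lemma scaled_weighting_near1 t i : 2 * n.+1%:R * similarity_gap t < 1 ->
  `|scaled_weighting t i - 1| <= 2 * n.+1%:R * similarity_gap t.
Proof.
move=> gap1; have nearZ := similarity_near_identity t.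
by apply: weighting_near1 nearZ _ (inv_weightingP nearZ _) i; lra.
Qed.

Lemma scaled_weighting_gt0 t i : 2 * n.+1%:R * similarity_gap t < 1 ->
  0 < scaled_weighting t i.
Proof.
move=> gap1; have := scaled_weighting_near1 i gap1.
by rewrite ler_norml; lra.
Qed.

Lemma scaled_weighting_cvg1 i : scaled_weighting t i @[t --> +oo] --> (1 : R).
Proof.
apply/cvgrPdist_lt => eps eps0.
apply: filterS2 (similarity_gap_lt ltr01) (similarity_gap_lt eps0) => t gap1 gap_eps.
rewrite distrC; exact: le_lt_trans (scaled_weighting_near1 i gap1) gap_eps.
Qed.

Definition scaled_maximiser t := point_masses (scaled_weighting t).

Lemma unique_maximising_scaled_maximiser :
  \forall t \near +oo, unique_maximising (scaled_dist t) (scaled_maximiser t).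
Proof.
apply: filterS (similarity_gap_lt ltr01) => t gap1.
have nearZ := similarity_near_identity t.
have nd : n.+1%:R * similarity_gap t < 1.
  have [_ _ /(_ ord0 ord0)] := nearZ.
  by move=> /(le_trans (normr_ge0 _)) /(mulr_ge0 (ler0n R n.+1)); lra.
have w0 j := scaled_weighting_gt0 j gap1.
apply: (unique_maximising_weighting bij_e _ nearZ nd (inv_weightingP nearZ nd) w0).
  by move=> i j; rewrite mxE.
by move=> i; exact: mass_point_masses.
Qed.

Lemma mass_scaled_maximiser_cvg i :
  mass e (scaled_maximiser t) i @[t --> +oo] --> (n.+1%:R^-1 : R).
Proof.
have : scaled_weighting t i / \sum_j scaled_weighting t j @[t --> +oo] -->
    1 / \sum_(j < n.+1) (1 : R).
  apply: cvgM; first exact: scaled_weighting_cvg1.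
  apply: cvgV; first by rewrite sumr_const card_ord pnatr_eq0.
  by apply: cvgr_sum => j _; exact: scaled_weighting_cvg1.
rewrite sumr_const card_ord mul1r; apply: cvg_trans; apply: near_eq_cvg.
apply: filterS (similarity_gap_lt ltr01) => t gap1.
by rewrite mass_point_masses// => j; exact: scaled_weighting_gt0.
Qed.

(** By uniqueness any such family eventually has the masses of [scaled_maximiser], so its integrals
    converge to uniform averages. One direction gives existence of the uniform measure, the other
    identifies it. *)
Lemma maximisers_cvgP (mu_ : R -> @weak_star R X) (mu : probability (borel X) R) :
  (\forall t \near +oo, unique_maximising (scaled_dist t) (mu_ t)) ->
  mu_ t @[t --> +oo] --> (mu : weak_star) <->
  forall i, mass e mu i = n.+1%:R^-1.
Proof.
move=> max_mu.
have mass_cvg i : mass e (mu_ t) i @[t --> +oo] --> (n.+1%:R^-1 : R).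
  apply: cvg_trans (mass_scaled_maximiser_cvg i); apply: near_eq_cvg.
  apply: filterS2 max_mu unique_maximising_scaled_maximiser => t [_ uniq_mu] [maxt _].
  congr fine; apply: (uniq_mu _ maxt); exact: (finite_borel_measurable bij_e).
have int_cvg (f : continuousType X R) :
    integral_of f (mu_ t) @[t --> +oo] --> \sum_i f (e i) / n.+1%:R.
  under eq_cvg do rewrite /integral_of (finite_Rintegral bij_e).
  by apply: cvgr_sum => i _; apply: cvgM (mass_cvg i); exact: cvg_cst.
split=> [/weak_star_cvgP cvg_mu i|mass_mu].
  (* The topology is discrete, so indicators of points are valid test functions, and they read off
     the masses of the limit. *)
  have ctsi : continuous (\1_[set e i] : X -> R).
    by apply/continuousP => A _; exact: (finite_metric_open bij_e).
  pose f : continuousType X R := mkcts ctsi.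
  have := cvg_unique (@Rhausdorff R) (cvg_mu f) (int_cvg f).
  rewrite /integral_of (finite_Rintegral bij_e).
  have sumE (c : 'I_n.+1 -> R) : \sum_j f (e j) * c j = c i.
    rewrite (bigD1 i)//= /f /mkcts indicE mem_set// mul1r big1 ?addr0// => j ji.
    rewrite indicE memNset ?mul0r// => /(bij_inj bij_e) ij.
    by rewrite ij eqxx in ji.
  by rewrite !sumE; apply; exact: fmap_proper_filter.
apply/(weak_star_cvgP (F := mu_ t @[t --> +oo])) => f.
rewrite /integral_of (finite_Rintegral bij_e).
by under eq_bigr do rewrite mass_mu; exact: int_cvg.
Qed.

End point_masses.

Theorem proposition9p4 (R : realType) (X : pmetricType R) (n : nat)
    (card_X : [set: X] #= `I_n) :
  (exists mu : probability (borel X) R, is_uniform_measure mu) /\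
  (forall mu : probability (borel X) R, is_uniform_measure mu ->
    forall x : X, mu [set x] = (n%:R^-1)%:E).
Proof.
case: n card_X => [|n] card_X.
  (* The chosen point of [X] rules out cardinality [0]. *)
  move: card_X; rewrite II0 card_eq0 => /eqP/seteqP[+ _].
  by move=> /(_ point)/(_ I).
have [e bij_e] : exists e : 'I_n.+1 -> X, bijective e.
  move: card_X; rewrite card_eq_sym => /pcard_eqP[h].
  exists (fun i => h i); rewrite -setTT_bijective; split=> //.
    move=> i j _ _ hij; apply/val_inj.
    by apply: ('inj_h) hij; rewrite inE /=.
  by move=> x _; have [k kn hk] := 'surj_h (I : setT x); exists (Ordinal kn).
split.
  (* Constant weights normalise to mass [1 / n.+1] at each point. *)
  exists (point_masses e (fun=> 1)), (scaled_maximiser e).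
  have max := unique_maximising_scaled_maximiser bij_e; split=> //.
  apply/(maximisers_cvgP bij_e _ max) => i.
  by rewrite mass_point_masses// sumr_const card_ord mul1r.
move=> mu [mu_ [max_mu cvg_mu]] x; have [f _ fK] := bij_e.
rewrite -(fK x); apply: etrans (massE bij_e _ _) _; congr EFin.
exact: ((maximisers_cvgP bij_e mu max_mu).1 cvg_mu).
Qed.
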